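(* Let $G_0 \xleftarrow{\varphi_0} G_1 \xleftarrow{\varphi_1} G_2 \xleftarrow{\varphi_2}\cdots$ be a sequence of covers of graphs with inverse limit $(X,f)$. Let $\mathcal{C}=\{\mathcal{C}_n\}_{n\in\mathbb{N}}$ be a system of circuits enumerated by $\mathbb{N}$ that expresses all invariant measures. Suppose that $\mathcal{C}$ has the system of winding matrices $\{\bar M_n\}_{n\in\mathbb{N}}$, where $\bar M_n=(\bar m_n(i,j))$ is a $(d_{n+1},d_n)$-matrix for each $n\in\mathbb{N}$. Suppose that there exist positive numbers $\epsilon_n>0$ $(n\in\mathbb{N})$ such that $\epsilon_n\le\bar M_n$ (i.e. $\epsilon_n\le\bar m_n(i,j)$ for all $i,j$) for all $n\in\mathbb{N}$, and that $\prod_{i=n}^\infty(1-d_i\epsilon_i)=0$ for all $n\in\mathbb{N}$. Then $(X,f)$ is uniquely ergodic.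
   Context: A graph is a pair $G=(V,E)$ with $V$ a finite set and $E \subseteq V\times V$ such that for each $v\in V$ there are edges $(u_1,v),(v,u_2)\in E$. A graph homomorphism $\varphi:(V_1,E_1)\to(V_2,E_2)$ is a map $\varphi:V_1\to V_2$ with $(\varphi\times\varphi)(E_1)\subseteq E_2$; for $e=(u,v)\in E_1$ write $\varphi(e)=(\varphi(u),\varphi(v))$. It is a cover if $(\varphi\times\varphi)(E_1)=E_2$ and $(u,v),(u,v')\in E_1$ implies $\varphi(v)=\varphi(v')$. In a sequence of covers, write $G_n=(V_n,E_n)$, $n\in\mathbb{N}=\{0,1,2,\dots\}$; each $\varphi_n:G_{n+1}\to G_n$ is a cover and $G_0=(\{0\},\{(0,0)\})$. The inverse limit $(X,f)$ is: $X=\{(x_0,x_1,\dots)\in\prod_i V_i : x_i=\varphi_i(x_{i+1})\ \forall i\}$ with the product topology, and $f:X\to X$ is the continuous surjection whose graph is $\{(x,y): (x_i,y_i)\in E_i\ \forall i\}$. For $v\in V_n$, $U(v)=\{x\in X:x_n=v\}$; for $e=(u,v)\in E_n$, $U(e)=U(u)\cap f^{-1}(U(v))$. For an $f$-invariant (finite) Borel measure $\mu$ on $X$, $\mu_n=\sum_{e\in E_n}\mu(U(e))e$ in the real vector space $\mathbb{R}^{E_n}$ with basis $E_n$. The linear map $(\varphi_n)_*$ is $(\varphi_n)_*(\sum_{e\in E_{n+1}}a(e)e)=\sum_{e\in E_{n+1}}a(e)\varphi_n(e)$. A circuit of $G$ is a closed walk $(v_0,\dots,v_l)$, $l\ge1$,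 $(v_i,v_{i+1})\in E$, $v_0=v_l$, with $v_0,\dots,v_{l-1}$ pairwise distinct, regarded as a subgraph $c$ with edge set $E(c)$ and period $\mathrm{Per}(c)=l$; $\mathrm{Circ}(G)$ is the set of all circuits. A circuit $c$ is identified with $\sum_{e\in E(c)}e$, and $\tilde{c}=(1/\mathrm{Per}(c))\,c$. A system of circuits enumerated by $\mathbb{N}$ is a sequence $\mathcal{C}=\{\mathcal{C}_n\}_{n\in\mathbb{N}}$ with $\mathcal{C}_n\subseteq\mathrm{Circ}(G_n)$. It expresses $\mu$ if for all $n$, $\mu_n=\sum_{c\in\mathcal{C}_n}s(c)\tilde{c}$ for some $s(c)\ge0$ ($c\in\mathcal{C}_n$). Winding matrices: $\mathcal{C}$ is said to have the system of winding matrices $\{\bar M_n\}$ in the following situation. There are non-negative integers $m(c,c')$ ($c\in\mathcal{C}_{n+1}$, $c'\in\mathcal{C}_n$, $n\in\mathbb{N}$) with $(\varphi_n)_*(c)=\sum_{c'\in\mathcal{C}_n}m(c,c')c'$ for all $c\in\mathcal{C}_{n+1}$ and all $n$. Fix a numbering $\mathcal{C}_n=\{c(n,1),\dots,c(n,d_n)\}$, with $d_n$ the number of elements of $\mathcal{C}_n$, and put $m_n(i,j)=m(c(n+1,i),c(n,j))$ and $l_n(i)=\mathrm{Per}(c(n,i))$. Then $\bar M_n$ is the $(d_{n+1},d_n)$-matrix with entries $\bar m_n(i,j)=\dfrac{l_n(j)}{l_{n+1}(i)}\,m_n(i,j)$; its rows sum to $1$. *)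

(* Defs.v *)
From HB Require Import structures.
From mathcomp Require Import all_boot all_order all_algebra.
From mathcomp Require Import all_classical all_reals all_analysis.

Set Implicit Arguments.
Unset Strict Implicit.
Unset Printing Implicit Defensive.

Import Order.TTheory GRing.Theory Num.Theory.
Import numFieldNormedType.Exports.

Local Open Scope classical_set_scope.
Local Open Scope ring_scope.

Record graph := Graph {
  vertex :> finType;
  edges : {set vertex * vertex};
  in_edgeP : forall v : vertex, exists u, (u, v) \in edges;
  out_edgeP : forall v : vertex, exists w, (v, w) \in edges }.

Definition edge (G : graph) := {e : G * G | e \in edges G}.
HB.instance Definition _ (G : graph) := SubFinite.on (edge G).

Record graph_hom (G H : graph) := GraphHom {
  hom_fun :> G -> H;
  hom_edgeP : forall u v, (u, v) \in edges G ->
    (hom_fun u, hom_fun v) \in edges H }.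

Lemma edge_map_proof (G H : graph) (phi : graph_hom G H) (e : edge G) :
  (phi (val e).1, phi (val e).2) \in edges H.
Proof. by apply: hom_edgeP; rewrite -surjective_pairing; exact: (valP e). Qed.

Definition edge_map (G H : graph) (phi : graph_hom G H) (e : edge G) : edge H :=
  exist _ (phi (val e).1, phi (val e).2) (edge_map_proof phi e).

Definition is_cover (G H : graph) (phi : graph_hom G H) : Prop :=
  (fun e : G * G => (phi e.1, phi e.2)) @: edges G = edges H /\
  (forall u v v', (u, v) \in edges G -> (u, v') \in edges G -> phi v = phi v').

Definition is_singleton_graph (G : graph) : Prop :=
  exists v : G, (forall u : G, u = v) /\ edges G = [set (v, v)]%SET.

Record cover_seq := CoverSeq {
  cgraph :> nat -> graph;
  cmap : forall n, graph_hom (cgraph n.+1) (cgraph n);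
  cmapP : forall n, is_cover (cmap n);
  cgraph0 : is_singleton_graph (cgraph 0) }.

Section InverseLimit.
Variable G : cover_seq.

Definition vertex_prod : Type :=
  prod_topology (fun n => discrete_topology (G n)).
HB.instance Definition _ := Topological.on vertex_prod.

Definition invlim_set : set vertex_prod :=
  [set x | forall i, x i = cmap G i (x i.+1)].

Definition invlim : Type := set_type invlim_set.
HB.instance Definition _ := Topological.on invlim.

Definition coord (x : invlim) (n : nat) : G n := set_val x n.

Lemma coordE (x : invlim) n : coord x n = cmap G n (coord x n.+1).
Proof. by case: x => x /= xP; have := set_mem xP; exact. Qed.

Lemma coord_inj (x y : invlim) : (forall n, coord x n = coord y n) -> x = y.
Proof.
move=> xy; apply: val_inj => /=.
by apply: functional_extensionality_dep => n; exact: xy.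
Qed.

Definition mk_invlim (x : forall n, G n)
  (xP : forall n, x n = cmap G n (x n.+1)) : invlim :=
  exist _ (x : vertex_prod) (mem_set (xP : invlim_set x)).

Lemma cmap_surj n (v : G n) : exists w : G n.+1, cmap G n w = v.
Proof.
have [u] := in_edgeP v; have [<- _] := cmapP G n.
by move=> /imsetP[[a b] _ [_ ->]]; exists b.
Qed.

Fixpoint thread (n : nat) : G n :=
  if n is m.+1 then projT1 (cid (cmap_surj (thread m)))
  else projT1 (cid (cgraph0 G)).

Lemma threadP n : thread n = cmap G n (thread n.+1).
Proof. by rewrite /=; case: cid. Qed.

HB.instance Definition _ := isPointed.Build invlim (mk_invlim threadP).

Lemma shift_ex (x : invlim) :
  exists y : invlim, forall i, (coord x i, coord y i) \in edges (G i).
Proof.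
pose w n := projT1 (cid (out_edgeP (coord x n))).
have wP n : (coord x n, w n) \in edges (G n) by rewrite /w; case: cid.
pose y n : G n := cmap G n (w n.+1).
have xyE n : (coord x n, y n) \in edges (G n).
  by rewrite coordE; apply: hom_edgeP.
have yP n : y n = cmap G n (y n.+1).
  by have [_] := cmapP G n; apply; [exact: wP|exact: xyE].
by exists (mk_invlim yP) => i; exact: xyE.
Qed.

Definition shift (x : invlim) : invlim := projT1 (cid (shift_ex x)).

Lemma shiftP (x y : invlim) :
  shift x = y <-> forall i, (coord x i, coord y i) \in edges (G i).
Proof.
rewrite /shift; case: cid => z /= zP; split=> [<- //|yP].
apply: coord_inj => n; rewrite (coordE z) (coordE y).
by have [_] := cmapP G n; apply; [exact: zP|exact: yP].
Qed.

Definition cyl_vertex n (v : G n) : set invlim := [set x | coord x n = v].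

Lemma cyl_vertex_open n (v : G n) : open (cyl_vertex v).
Proof.
have projc : continuous (proj n : vertex_prod -> discrete_topology (G n)).
  exact: proj_continuous.
have /continuousP/(_ _ (discrete_open [set (v : discrete_topology (G n))])) :
    continuous (fun x : invlim => proj n (set_val x)).
  move=> x; apply: continuous_comp; first exact: initial_continuous.
  exact: projc.
by [].
Qed.

Definition cyl_edge n (e : edge (G n)) : set invlim :=
  cyl_vertex (val e).1 `&` shift @^-1` cyl_vertex (val e).2.

Definition borel : Type := g_sigma_algebraType (@open invlim).
HB.instance Definition _ := Measurable.on borel.

End InverseLimit.

Arguments coord {G} x n.
Arguments shift {G} x.

Definition bvec (R : realType) (G : graph) (e : edge G) : {ffun edge G -> R^o} :=
  [ffun e' => (e' == e)%:R].

Definition pushforward_edges (R : realType) (G H : graph) (phi : graph_hom G H)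
    (a : {ffun edge G -> R^o}) : {ffun edge H -> R^o} :=
  \sum_(e : edge G) a e *: bvec R (edge_map phi e).

(* The edges of the closed walk (v_0, ..., v_{l-1}, v_0), where
   [s] is the list of the pairwise distinct v_0, ..., v_{l-1}. *)
Definition walk_edges (G : graph) (s : seq G) : {set edge G} :=
  [set e | ((val e).1 \in s) && ((val e).2 == next s (val e).1)]%SET.

(* A circuit, as a subgraph, is determined by its edge set. *)
Definition is_circuit (G : graph) (c : {set edge G}) : Prop :=
  exists s : seq G, [/\ s != [::], uniq s,
    path.cycle (fun u v => (u, v) \in edges G) s & c = walk_edges s].

Definition Circ (G : graph) : {set {set edge G}} :=
  [set c | `[< is_circuit c >]]%SET.

(* The number of edges of a circuit is the length of the walk that
   traces it, by [Per_walk]. *)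
Definition Per (G : graph) (c : {set edge G}) : nat := #|c|.

Lemma Per_walk (G : graph) (s : seq G) :
  uniq s -> path.cycle (fun u v => (u, v) \in edges G) s ->
  Per (walk_edges s) = size s.
Proof.
move=> us cs; rewrite /Per -(card_uniqP us).
rewrite -(@card_in_imset _ _ (fun e : edge G => (val e).1)); last first.
  move=> [[a b] abE] [[a' b'] abE']; rewrite !inE /=.
  move=> /andP[_ /eqP bE] /andP[_ /eqP bE'] aa'; apply: val_inj => /=.
  by rewrite bE bE' aa'.
apply: eq_card => v; apply/imsetP/idP => [[e]|vs].
  by rewrite inE => /andP[? _] ->.
by exists (exist _ (v, next s v) (next_cycle cs vs)) => //; rewrite inE /= vs eqxx.
Qed.

Definition circ_vec (R : realType) (G : graph) (c : {set edge G}) :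
    {ffun edge G -> R^o} :=
  \sum_(e in c) bvec R e.

Definition circ_nvec (R : realType) (G : graph) (c : {set edge G}) :
    {ffun edge G -> R^o} :=
  (Per c)%:R^-1 *: circ_vec R c.

Definition invariant_measure (R : realType) (G : cover_seq)
    (mu : set (borel G) -> \bar R) : Prop :=
  forall A : set (borel G), measurable A ->
    mu ((shift : borel G -> borel G) @^-1` A) = mu A.

Definition measure_vec (R : realType) (G : cover_seq)
    (mu : {finite_measure set (borel G) -> \bar R}) (n : nat) :
    {ffun edge (G n) -> R^o} :=
  \sum_(e : edge (G n)) (fine (mu (cyl_edge e)) : R) *: bvec R e.

Definition circuit_family (G : cover_seq) := forall n, {set {set edge (G n)}}.

Definition circuit_system (G : cover_seq) (C : circuit_family G) : Prop :=
  forall n, C n \subset Circ (G n).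

Definition expresses (R : realType) (G : cover_seq) (C : circuit_family G)
    (mu : {finite_measure set (borel G) -> \bar R}) : Prop :=
  forall n, exists s : {set edge (G n)} -> R,
    (forall c, c \in C n -> 0 <= s c) /\
    measure_vec mu n = \sum_(c in C n) s c *: circ_nvec R c.

Definition expresses_all (R : realType) (G : cover_seq)
    (C : circuit_family G) : Prop :=
  forall mu : {finite_measure set (borel G) -> \bar R},
    invariant_measure mu -> expresses C mu.

Definition winding_numbers (R : realType) (G : cover_seq)
    (C : circuit_family G)
    (m : forall n, {set edge (G n.+1)} -> {set edge (G n)} -> nat) : Prop :=
  forall n c, c \in C n.+1 ->
    pushforward_edges (cmap G n) (circ_vec R c) =
      \sum_(c' in C n) (m n c c')%:R *: circ_vec R c'.

Definition numbering (G : cover_seq) (C : circuit_family G)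
    (c : forall n, 'I_#|C n| -> {set edge (G n)}) : Prop :=
  forall n, injective (c n) /\ [set c n i | i : 'I_#|C n|]%SET = C n.

Definition has_winding_matrices (R : realType) (G : cover_seq)
    (C : circuit_family G)
    (M : forall n, 'M[R]_(#|C n.+1|, #|C n|)) : Prop :=
  exists (m : forall n, {set edge (G n.+1)} -> {set edge (G n)} -> nat)
         (c : forall n, 'I_#|C n| -> {set edge (G n)}),
    [/\ winding_numbers R C m, numbering c &
      forall n i j,
        M n i j = (Per (c n j))%:R / (Per (c n.+1 i))%:R
                  * (m n (c n.+1 i) (c n j))%:R].

(* Equality of measures is only meaningful on measurable sets, since measures
   are represented by functions on all sets. *)
Definition uniquely_ergodic (R : realType) (G : cover_seq) : Prop :=
  exists mu : probability (borel G) R, invariant_measure mu /\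
    forall nu : probability (borel G) R, invariant_measure nu ->
      forall A : set (borel G), measurable A -> nu A = mu A.

(* Main.v *)
Require Import Defs.
From HB Require Import structures.
From mathcomp Require Import all_boot all_order all_algebra.
From mathcomp Require Import finmap ring lra.
From mathcomp Require Import all_classical all_reals all_analysis.
Import Order.TTheory GRing.Theory Num.Theory.
Import numFieldNormedType.Exports.
Import Defs.
Local Open Scope classical_set_scope.
Local Open Scope ring_scope.

(** Unique ergodicity is existence and uniqueness of an invariant probability
    measure.

    Existence holds for the inverse limit of any sequence of covers, by the
    Krylov-Bogoliubov argument.  Averaging indicator functions along an orbit
    and passing to the limit along an ultrafilter yields a shift-invariant,
    finitely additive mean on all subsets ([invariant_mean]).  On a compact
    space, a clopen set cannot be a disjoint union of infinitely many nonempty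
    clopen sets, so a finitely additive mean is automatically a premeasure on
    the algebra of clopen sets, and Caratheodory's theorem extends it to a
    probability on the sigma-algebra they generate
    ([clopen_premeasure_extension]).  In the inverse limit the clopen sets
    generate the Borel sets, and invariance carries over from cylinders to
    Borel sets because cylinders form a generating pi-system
    ([eq_probability_cyl]).

    For uniqueness, let [mu] and [nu] be two invariant probabilities and let
    [a n] be the difference of their vectors in the edge space at level [n].
    The vectors of a measure at successive levels are related by pushforward, so
    [a n] is the image of [a (n + k)] for every [k].  Since the circuits express
    both measures, [a (n + k)] is a combination of normalized circuits whose
    coefficients sum to 0 and whose l1 norm is at most 2.  Pushing normalized
    circuits forward by one level multiplies coefficient vectors by the winding
    matrix, which is row stochastic with entries at least [eps]; on zero-sum
    vectors such a matrix contracts the l1 norm by [1 - d * eps], because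
    subtracting the constant [eps] from all its entries does not change its
    action ([stochastic_contraction]).  Hence every coordinate of [a n] is
    bounded by twice the partial product of the factors [1 - d_i * eps_i] from
    [n] to [n + k], which tends to 0, so [a n = 0] ([measure_vec_unique]).  The
    two measures thus agree on all cylinders, hence on all Borel sets. *)

(** * An invariant finitely additive mean *)

(** An ultrafilter cannot avoid a neighborhood of one of its cluster points, so
    it converges to it. *)
Lemma bounded_ultra_cvg (R : realType) (I : Type) (F : set_system I)
    (u : I -> R) (a b : R) :
  UltraFilter F -> (forall i, a <= u i <= b) -> exists l : R, u @ F --> l.
Proof.
move=> FU uab; have [] := @segment_compact R a b (u @ F) _.
  by apply: (filterE (F := F)) => i /=; rewrite in_itv/=; exact: uab.
move=> l [_ cl]; exists l => U Ul.
have [//|FnU] := in_ultra_setVsetC (u @^-1` U) FU.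
by have [y [yU]] := cl _ _ (FnU : (u @ F) (~` U)) Ul.
Qed.

(** The mean of [A] is the ultralimit of the frequency of visits to [A] of the
    orbit of [x0].  It is invariant because shifting the orbit by one step
    changes an average of length [n + 1] by at most [1 / (n + 1)]. *)
Lemma invariant_mean (R : realType) (T : Type) (f : T -> T) (x0 : T) :
  exists m : set T -> R, [/\ forall A, 0 <= m A, m setT = 1,
    forall A B, A `&` B = set0 -> m (A `|` B) = m A + m B
    & forall A, m (f @^-1` A) = m A].
Proof.
have [F [FU ooF]] := ultraFilterLemma eventually_filter.
pose avg (A : set T) (n : nat) : R :=
  n.+1%:R^-1 * \sum_(i < n.+1) \1_A (iter i f x0).
have ind01 (A : set T) x : 0 <= (\1_A x : R) <= 1.
  by rewrite indicE; case: (_ \in _); rewrite ler01 lexx.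
have avg0 A n : 0 <= avg A n.
  by rewrite mulr_ge0// sumr_ge0// => i _; case/andP: (ind01 A (iter i f x0)).
have avg_cvg A : exists l : R, avg A @ F --> l.
  apply: (@bounded_ultra_cvg _ _ _ _ 0 1) => n; rewrite avg0/=.
  rewrite /avg mulrC ler_pdivrMr// mul1r.
  rewrite -[n.+1 in leRHS]card_ord -sum1_card natr_sum ler_sum// => i _.
  by case/andP: (ind01 A (iter i f x0)).
pose m A := projT1 (cid (avg_cvg A)).
have mP A : avg A @ F --> m A by rewrite /m; case: cid.
have mE A l : avg A @ F --> l -> m A = l.
  by move=> Al; exact: (@cvg_unique _ (@norm_hausdorff _ R) _ _ _ _ (mP A) Al).
exists m; split.
- move=> A; apply: (closed_cvg _ (@closed_ge R 0) _ _ (mP A)).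
  by apply: (filterE (F := F)) => n; exact: avg0.
- apply: mE; have -> : avg setT = cst 1; last exact: cvg_cst.
  apply/funext => n; rewrite /avg.
  rewrite (eq_bigr (fun=> 1)); last by move=> i _; rewrite indicT.
  by rewrite sumr_const card_ord mulVf.
- move=> A B AB; apply: mE.
  have -> : avg (A `|` B) = avg A \+ avg B.
    apply/funext => n; rewrite /avg /= -mulrDr -big_split/=; congr (_ * _).
    apply: eq_bigr => i _; move: (iter i f x0) => x; rewrite !indicE in_setU.
    case: (boolP (x \in A)) => /= xA;
      case: (boolP (x \in B)) => xB; rewrite ?addr0 ?add0r//.
    by have : set0 x; [rewrite -AB; split; exact/set_mem|].
  exact: cvgD.
- move=> A; apply: mE.
  (* the averages telescope: only the two ends of the orbit segment differ *)
  pose d (n : nat) : R := n.+1%:R^-1 * (\1_A (iter n.+1 f x0) - \1_A x0).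
  have -> : avg (f @^-1` A) = avg A \+ d.
    apply/funext => n; rewrite /avg /d /= -mulrDr; congr (_ * _).
    rewrite big_ord_recr/= [in RHS]big_ord_recl/= [RHS]addrC addrA subrK.
    by rewrite addrC; congr (_ + _); apply: eq_bigr.
  rewrite -[X in _ --> X]addr0; apply: cvgD; first exact: mP.
  apply: (cvg_trans (G := d @ \oo)); first by move=> U; exact: ooF.
  apply: (@squeeze_cvgr _ _ _ _ (fun n => - harmonic n) (@harmonic R)).
  + apply: nearW => n; rewrite /d /harmonic /=.
    have k0 : 0 <= n.+1%:R^-1 :> R by rewrite invr_ge0.
    have /andP[a0 a1] := ind01 A (f (iter n f x0)).
    have /andP[b0 b1] := ind01 A x0.
    move: (n.+1%:R^-1) (\1_A _) (\1_A x0) k0 a0 a1 b0 b1 => k a b *.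
    by apply/andP; split; nra.
  + by rewrite -oppr0; apply: cvgN; exact: cvg_harmonic.
  + exact: cvg_harmonic.
Qed.

(** * From clopen sets to Borel sets *)

(** A copy of the space whose measurable sets are the clopen sets: it carries
    the domain of a premeasure, whereas the space itself is to carry the Borel
    sets. *)
Definition clopen_algebra (T : Type) : Type := T.

Fact clopen_display : measure_display.
Proof. exact: default_measure_display. Qed.

Section ClopenAlgebra.
Variable T : ptopologicalType.

Lemma clopen_setC (A : set T) : clopen A -> clopen (~` A).
Proof. by move=> [oA cA]; split; [exact: closed_openC|exact: open_closedC]. Qed.

HB.instance Definition _ := Pointed.on (clopen_algebra T).
HB.instance Definition _ := isAlgebraOfSets.Build clopen_display
  (clopen_algebra T) (@clopen0 T) (@clopenU T) clopen_setC.

End ClopenAlgebra.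

(** This is the reason why additivity and sigma-additivity coincide on clopen
    sets: a closed union of open sets is compact, hence covered by finitely many
    of them, and disjointness leaves nothing for the others. *)
Lemma compact_trivIset_clopen (T : ptopologicalType) (F : (set T)^nat) :
  compact [set: T] -> (forall i, open (F i)) -> trivIset setT F ->
  closed (\bigcup_i F i) ->
  exists N, forall i, (N <= i)%N -> F i = set0.
Proof.
move=> cT oF tF clF.
have : compact (\bigcup_i F i).
  exact: subclosed_compact clF cT (@subsetT _ _).
rewrite compact_cover => /(_ _ setT F) [|//|D _ UD].
  by move=> i _; exact: oF.
exists (\max_(i <- enum_fset D) i).+1 => i Ni.
apply/seteqP; split=> // x Fix; have [|j jD Fjx] := UD x; first by exists i.
have ji : j = i by apply: (tF j i) => //; exists x.
move: Ni; rewrite -ji ltnNge; apply: contraNP => _.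
exact: (@leq_bigmax_seq _ (enum_fset D) xpredT id).
Qed.

(** The hypothesis on open sets, that they are countable unions of clopen sets,
    puts the Borel sets inside the sigma-algebra generated by the clopen sets,
    where the Caratheodory extension is defined. *)
Lemma clopen_premeasure_extension (R : realType) (T : ptopologicalType)
    (m : set T -> R) :
  compact [set: T] ->
  (forall U : set T, open U -> exists F : (set T)^nat,
    (forall i, clopen (F i)) /\ U = \bigcup_i F i) ->
  (forall A, 0 <= m A) -> m setT = 1 ->
  (forall A B, A `&` B = set0 -> m (A `|` B) = m A + m B) ->
  exists mu : probability (g_sigma_algebraType (@open T)) R,
    forall A, clopen A -> mu A = (m A)%:E.
Proof.
move=> cT baseT m_ge0 mT mU.
have m0 : m set0 = 0.
  by apply: (@addrI _ (m setT)); rewrite -mU ?setU0 ?setI0// addr0.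
pose pre (A : set (clopen_algebra T)) := (m A)%:E.
have pre0 : pre set0 = 0%E by rewrite /pre m0.
have pre_ge0 A : (0 <= pre A)%E by rewrite lee_fin.
have pre_sum (F : (set T)^nat) n : trivIset setT F ->
    (\sum_(0 <= i < n) pre (F i))%E = pre (\big[setU/set0]_(i < n) F i).
  move=> tF; rewrite big_mkord; elim: n => [|n IH]; first by rewrite !big_ord0.
  rewrite !big_ord_recr/= IH /pre -EFinD -mU// -bigcup_mkord.
  by apply/seteqP; split=> // x [[i /= ni Fi] Fn]; move: ni;
    rewrite (tF i n) ?ltnn//; exists x.
have pre_sigma : semi_sigma_additive pre.
  move=> F cF tF [oU clU].
  have [N FN] := compact_trivIset_clopen _ _ cT (fun i => (cF i).1) tF clU.
  apply: cvg_near_cst; exists N => // n /= Nn; rewrite pre_sum//; congr pre.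
  rewrite -bigcup_mkord; apply/seteqP; split=> [x [i _ Fi]|x [i _ Fi]].
    by exists i.
  exists i => //=; rewrite ltnNge; apply/negP => ni.
  by move: Fi; rewrite FN//; exact: leq_trans ni.
pose premu : {measure set (clopen_algebra T) -> \bar R} :=
  HB.pack pre (isMeasure.Build _ _ _ pre pre0 pre_ge0 pre_sigma).
pose ext := measure_extension premu.
have extE (A : set T) : clopen A -> ext A = (m A)%:E.
  by move=> cA; rewrite /ext /measure_extension measurable_mu_extE.
have open_clopen (A : set T) : <<s @open T >> A -> <<s @clopen T >> A.
  apply: smallest_sub; first exact: smallest_sigma_algebra.
  move=> U oU; have [F [cF ->]] := baseT U oU.
  apply: sigma_algebra_bigcup => i.
  by apply: sub_sigma_algebra; exact: cF.
pose nu (A : set (g_sigma_algebraType (@open T))) := ext A.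
have nu0 : nu set0 = 0%E by exact: (measure0 (measure_extension premu)).
have nu_ge0 A : (0 <= nu A)%E by exact: (measure_ge0 (measure_extension premu)).
have nu_sigma : semi_sigma_additive nu.
  move=> F mF tF mUF.
  apply: (@measure_semi_sigma_additive _ _ _ (measure_extension premu)) => //.
    by move=> i; exact: (open_clopen (F i) (mF i)).
  exact: (open_clopen _ mUF).
have nuT : nu setT = 1%E.
  by rewrite /nu extE ?mT//; split; [exact: openT|exact: closedT].
pose numeas : {measure set (g_sigma_algebraType (@open T)) -> \bar R} :=
  HB.pack nu (isMeasure.Build _ _ _ nu nu0 nu_ge0 nu_sigma).
pose P : probability (g_sigma_algebraType (@open T)) R :=
  HB.pack (Measure.sort numeas) (Measure_isProbability.Build _ _ _ numeas nuT).
by exists P => A cA; rewrite /= /nu extE.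
Qed.

(** * Topology of the inverse limit *)

Section InverseLimitTopology.
Variable G : cover_seq.
Implicit Types (x y : invlim G) (n : nat).

Lemma coord_eqW x y n k : (n <= k)%N -> coord x k = coord y k ->
  coord x n = coord y n.
Proof.
move=> nk; rewrite -(subnKC nk); elim: (k - n)%N => [|j IH].
  by rewrite addn0.
by rewrite addnS => xy; apply: IH; rewrite (coordE x) (coordE y) xy.
Qed.

(** The cover condition: all edges out of a vertex of level [n + 1] end over the
    same vertex of level [n]. *)
Lemma coord_shift x y n : coord x n.+1 = coord y n.+1 ->
  coord (shift x) n = coord (shift y) n.
Proof.
move=> xy; rewrite (coordE (shift x)) (coordE (shift y)).
have [_] := cmapP G n; apply; first exact: (proj1 (shiftP x (shift x)) erefl).
by rewrite xy; exact: (proj1 (shiftP y (shift y)) erefl).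
Qed.

Lemma invlim_cvg (F : set_system (invlim G)) x : Filter F ->
  (forall n, F (cyl_vertex (coord x n))) -> F --> x.
Proof.
move=> FF Fc.
have valF :
    (set_val @ F : set_system (vertex_prod G)) --> (set_val x : vertex_prod G).
  apply/cvg_sup => n A; rewrite (@nbhsE (initial_topology _)).
  move=> -[B [[D _ <-] Dx] sBA].
  have cylA : cyl_vertex (coord x n) `<=` (set_val : invlim G -> _) @^-1` A.
    by move=> y yx; apply: sBA; rewrite /= -[set_val y n]/(coord y n) yx.
  exact: filterS cylA (Fc n).
move=> A; rewrite (@nbhsE (invlim G)) => -[B [[D oD <-] Dx] sBA].
apply: filterS sBA _; apply: valF; exact: open_nbhs_nbhs.
Qed.

(** The filter generated by the cylinders around [x] converges to [x], so it
    contains every neighborhood of [x]. *)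
Lemma invlim_nbhsP x (A : set (invlim G)) :
  nbhs x A <-> exists n, cyl_vertex (coord x n) `<=` A.
Proof.
split=> [xA|[n nA]]; last first.
  apply: filterS nA _; apply: open_nbhs_nbhs.
  by split=> //; exact: cyl_vertex_open.
pose F : set_system (invlim G) :=
  filter_from setT (fun n => cyl_vertex (coord x n)).
have FF : Filter F.
  apply: filter_from_filter; first by exists 0%N.
  move=> i j _ _; exists (maxn i j) => // y yx.
  by split; apply: coord_eqW yx; [exact: leq_maxl|exact: leq_maxr].
have [|n _ nA] := invlim_cvg F x FF _ A xA; last by exists n.
by move=> n; exists n.
Qed.

Lemma invlim_openP (U : set (invlim G)) :
  open U <-> forall x, U x -> exists n, cyl_vertex (coord x n) `<=` U.
Proof.
rewrite openE; split=> [oU x Ux|oU x Ux]; first exact/invlim_nbhsP/oU.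
exact/invlim_nbhsP/oU.
Qed.

Lemma coord_preimage_clopen n (P : set (G n)) : clopen [set x | P (coord x n)].
Proof.
have op (Q : set (G n)) : open [set x | Q (coord x n)].
  by apply: (proj2 (invlim_openP _)) => x Qx; exists n => y /= ->.
by split; [exact: op|rewrite -openC; exact: (op (~` P))].
Qed.

Lemma cyl_vertex_clopen n (v : G n) : clopen (cyl_vertex v).
Proof. exact: (coord_preimage_clopen n [set v]). Qed.

Lemma open_bigcup_coord (U : set (invlim G)) : open U ->
  U = \bigcup_n [set x | cyl_vertex (coord x n) `<=` U].
Proof.
move=> oU; apply/seteqP; split=> x.
  by move/(proj1 (invlim_openP U) oU) => [n nU]; exists n.
by move=> [n _]; apply.
Qed.

(** An ultrafilter selects exactly one vertex at each of the finite levels;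
    these vertices are compatible, and they form the point it converges to. *)
Lemma invlim_compact : compact [set: invlim G].
Proof.
rewrite compact_ultra => F FU _.
have Fv n : exists v : G n, F (cyl_vertex v).
  apply: contrapT => nFv.
  have : \forall x \near F, forall v : G n, ~ cyl_vertex v x.
    apply: filter_forall => v.
    have [Fv|//] := in_ultra_setVsetC (cyl_vertex v) FU.
    by exfalso; apply: nFv; exists v.
  by move/filter_ex => [x] /(_ (coord x n)); apply.
pose v n := projT1 (cid (Fv n)).
have vP n : F (cyl_vertex (v n)) by rewrite /v; case: cid.
have vE n : v n = cmap G n (v n.+1).
  have [x [/= <- <-]] := filter_ex (filterI (vP n) (vP n.+1)).
  exact: coordE.
exists (mk_invlim vE); split=> //; apply: invlim_cvg => n; exact: vP.
Qed.

Lemma shift_preimage_open (U : set (invlim G)) : open U -> open (shift @^-1` U).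
Proof.
move=> oU; apply: (proj2 (invlim_openP _)) => x.
move=> /(proj1 (invlim_openP U) oU)[n nU].
by exists n.+1 => y yx; apply: nU; exact: coord_shift.
Qed.

Lemma measurable_shift : measurable_fun setT (shift : borel G -> borel G).
Proof.
apply: (@measurability _ _ _ _ setT (shift : borel G -> borel G)
  (@open (invlim G))) => //.
move=> _ [U oU <-]; rewrite setTI; apply: sub_sigma_algebra.
exact: shift_preimage_open.
Qed.

Lemma measurable_coord_preimage n (P : set (G n)) :
  measurable ([set x | P (coord x n)] : set (borel G)).
Proof. by apply: sub_sigma_algebra; have [] := coord_preimage_clopen n P. Qed.

End InverseLimitTopology.

(** * Existence of an invariant probability measure *)

Lemma cyl_vertex0 (G : cover_seq) (v : G 0%N) : cyl_vertex v = [set: invlim G].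
Proof.
apply/seteqP; split=> // x _; have [w [wE _]] := cgraph0 G.
by rewrite /cyl_vertex /= (wE (coord x 0)) (wE v).
Qed.

(** Cylinders form a tree: the one of lower level contains the other or is
    disjoint from it. *)
Lemma cyl_vertex_setI (G : cover_seq) n k (v : G n) (w : G k) : (n <= k)%N ->
  cyl_vertex v `&` cyl_vertex w = cyl_vertex w \/
  cyl_vertex v `&` cyl_vertex w = set0.
Proof.
move=> nk.
have [[x [xv xw]]|nvw] := pselect (cyl_vertex v `&` cyl_vertex w !=set0).
  left; rewrite setIidr// => y yw; rewrite /cyl_vertex/= -xv.
  by apply: coord_eqW nk _; rewrite xw.
by right; apply/seteqP; split=> // x vwx; apply: nvw; exists x.
Qed.

(** Cylinders, together with the empty set, form a pi-system, and each open set
    is a countable union of them. *)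
Lemma eq_probability_cyl (R : realType) (G : cover_seq)
    (mu nu : probability (borel G) R) :
  (forall n (v : G n), mu (cyl_vertex v) = nu (cyl_vertex v)) ->
  forall A : set (borel G), measurable A -> mu A = nu A.
Proof.
move=> munu; pose H : set (set (borel G)) :=
  [set A | A = set0 \/ exists n (v : G n), A = cyl_vertex v].
have HT : H setT by right; exists 0%N, (thread G 0); rewrite cyl_vertex0.
apply: (measure_unique H (fun=> setT)) => //.
- apply/seteqP; split; apply: smallest_sub; [|move=> U oU| |].
  + exact: smallest_sigma_algebra.
  + rewrite (open_bigcup_coord _ _ oU); apply: sigma_algebra_bigcup => n.
    rewrite (_ : mkset _ =
        \bigcup_(v in [set v : G n | cyl_vertex v `<=` U]) cyl_vertex v).
      apply: (@fin_bigcup_measurable _ (g_sigma_algebraType H)) => // v _.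
      by apply: sub_sigma_algebra; right; exists n, v.
    by apply/seteqP; split=> [x xU|x [v vU xv]];
      [exists (coord x n)|rewrite /= xv].
  + exact: smallest_sigma_algebra.
  + move=> A [->|[n [v ->]]]; first exact: measurable0.
    by apply: sub_sigma_algebra; have [] := cyl_vertex_clopen _ n v.
- move=> A B [->|[n [v ->]]]; first by rewrite set0I; left.
  move=> [->|[k [w ->]]]; first by rewrite setI0; left.
  have [nk|/ltnW kn] := leqP n k.
    by have [->|->] := cyl_vertex_setI _ _ _ v w nk; [right; exists k, w|left].
  rewrite setIC.
  by have [->|->] := cyl_vertex_setI _ _ _ w v kn; [right; exists n, v|left].
- by rewrite bigcup_const//; exists 0%N.
- by move=> A [->|[n [v ->]]]; rewrite ?measure0//; exact: munu.
- move=> _; apply: (le_lt_trans (probability_le1 mu measurableT)).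
  by rewrite ltry.
Qed.

(** Krylov-Bogoliubov theorem for the inverse limit.  The mean is invariant on
    all sets and the measure agrees with it on clopen sets, so the measure is
    invariant on cylinders. *)
Lemma invariant_probability_exists (R : realType) (G : cover_seq) :
  exists mu : probability (borel G) R, invariant_measure mu.
Proof.
have [m [m_ge0 mT mU mshift]] := invariant_mean R _ (@shift G) point.
have [mu muE] : exists mu : probability (borel G) R,
    forall A : set (invlim G), clopen A -> mu A = (m A)%:E.
  apply: clopen_premeasure_extension => //; first exact: invlim_compact.
  move=> U oU; exists (fun n => [set x | cyl_vertex (coord x n) `<=` U]).
  split; last exact: open_bigcup_coord.
  by move=> n; exact: (coord_preimage_clopen _ n [set v | cyl_vertex v `<=` U]).
exists mu => A mA.
pose mshift_fun : {mfun borel G >-> borel G} := HB.pack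
  (shift : borel G -> borel G)
  (isMeasurableFun.Build _ _ _ _ _ (measurable_shift G)).
pose smu : probability (borel G) R := distribution mu mshift_fun.
suff : smu A = mu A by [].
apply: (eq_probability_cyl _ _ smu mu _ _ mA).
move=> n v; rewrite /= /distribution /pushforward !muE ?mshift//.
  exact: cyl_vertex_clopen.
have [ov cv] := cyl_vertex_clopen G n v.
split; first exact: shift_preimage_open.
rewrite -openC preimage_setC; apply: shift_preimage_open.
by rewrite openC.
Qed.

(** * Edge vectors of circuits *)

Section EdgeVectors.
Variable R : realType.

Lemma sum_bvec (H : graph) (a : {ffun edge H -> R^o}) e :
  (\sum_e' a e' *: bvec R e') e = a e.
Proof.
rewrite sum_ffunE (bigD1 e)//= big1 ?addr0 => [|e' e'e].
  by rewrite !ffunE eqxx; exact: mulr1.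
by rewrite !ffunE eq_sym (negbTE e'e); exact: mulr0.
Qed.

Lemma pushforward_edgesE (H K : graph) (phi : graph_hom H K)
    (a : {ffun edge H -> R^o}) e :
  pushforward_edges phi a e = \sum_(e' | edge_map phi e' == e) a e'.
Proof.
rewrite sum_ffunE [RHS]big_mkcond; apply: eq_bigr => e' _.
rewrite !ffunE eq_sym; case: eqP => _ /=; first exact: mulr1.
exact: mulr0.
Qed.

Lemma sum_pushforward_edges (H K : graph) (phi : graph_hom H K)
    (a : {ffun edge H -> R^o}) :
  \sum_e pushforward_edges phi a e = \sum_e a e.
Proof.
rewrite (eq_bigr _ (fun e _ => pushforward_edgesE _ _ phi a e)).
rewrite (exchange_big_dep xpredT)//=; apply: eq_bigr => e _.
by rewrite (big_pred1 (edge_map phi e)) => // e'; rewrite eq_sym.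
Qed.

Lemma pushforward_edgesB (H K : graph) (phi : graph_hom H K)
    (a b : {ffun edge H -> R^o}) :
  pushforward_edges phi (a - b) =
    pushforward_edges phi a - pushforward_edges phi b.
Proof.
have subE (I : finType) (u v : {ffun I -> R^o}) i : (u - v) i = u i - v i.
  by rewrite !ffunE.
apply/ffunP => e; rewrite subE !pushforward_edgesE -sumrB.
by apply: eq_bigr => e' _; rewrite subE.
Qed.

Lemma pushforward_edges_comb (H K : graph) (phi : graph_hom H K) (I : finType)
    (A : {set I}) (x : I -> R) (a : I -> {ffun edge H -> R^o}) :
  pushforward_edges phi (\sum_(i in A) x i *: a i) =
    \sum_(i in A) x i *: pushforward_edges phi (a i).
Proof.
apply/ffunP => e; rewrite pushforward_edgesE sum_ffunE.
under eq_bigr do rewrite sum_ffunE.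
rewrite exchange_big; apply: eq_bigr => i _.
rewrite ffunE pushforward_edgesE scaler_sumr; apply: eq_bigr => e' _.
by rewrite ffunE.
Qed.

Lemma circ_nvecE (H : graph) (c : {set edge H}) e :
  circ_nvec R c e = (Per c)%:R^-1 * (e \in c)%:R.
Proof.
rewrite ffunE sum_ffunE; congr (_ * _).
have bvecE e' : bvec R e' e = (e == e')%:R by rewrite ffunE.
have [ec|eNc] := boolP (e \in c); last first.
  by rewrite big1// => e' e'c; rewrite bvecE; case: eqP e'c eNc => // -> ->.
rewrite (bigD1 e)//= big1 ?addr0 ?bvecE ?eqxx// => e' /andP[_ e'e].
by rewrite bvecE eq_sym (negbTE e'e).
Qed.

(** This includes the empty edge set, whose normalized vector is 0. *)
Lemma circ_nvec_le1 (H : graph) (c : {set edge H}) e : `|circ_nvec R c e| <= 1.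
Proof.
rewrite circ_nvecE normrM normfV !normr_nat.
case: (boolP (e \in c)) => [ec|_]; last by rewrite mulr0 ler01.
rewrite mulr1 invf_le1 ?ltr0n ?ler1n /Per card_gt0; apply/set0Pn; by exists e.
Qed.

Lemma Per_neq0 (H : graph) (c : {set edge H}) :
  c \in Circ H -> (Per c)%:R != 0 :> R.
Proof.
rewrite inE => /asboolP[s [s0 us cs ->]].
by rewrite Per_walk// pnatr_eq0 size_eq0.
Qed.

Lemma sum_circ_nvec (H : graph) (c : {set edge H}) : c \in Circ H ->
  \sum_e circ_nvec R c e = 1.
Proof.
move=> cH; rewrite (eq_bigr _ (fun e _ => circ_nvecE H c e)) -mulr_sumr.
by rewrite -natr_sum -big_mkcond/= sum1_card mulVf ?Per_neq0.
Qed.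

End EdgeVectors.

(** * Edge vectors of measures *)

Lemma fine_measure_fibers (d : measure_display) (T : measurableType d)
    (R : realType) (mu : {finite_measure set T -> \bar R}) (I : finType)
    (g : T -> I) (P : pred I) :
  (forall i, measurable (g @^-1` [set i])) ->
  fine (mu [set x | P (g x)]) = \sum_(i | P i) fine (mu (g @^-1` [set i])).
Proof.
move=> mg.
rewrite (_ : mkset _ = \bigcup_(i in [set` P]) g @^-1` [set i]); last first.
  by apply/seteqP; split=> [x Px|x [i Pi gx]]; [exists (g x)|rewrite /= gx].
rewrite measure_fin_bigcup//; last first.
  apply/trivIsetP => i j _ _ ij.
  by apply/seteqP; split=> // x [/= -> /eqP]; apply/negP.
rewrite -(@bigfs _ _ _ _ (index_enum I)); last 2 first.
- exact: index_enum_uniq.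
- by move=> i _; rewrite mem_index_enum.
by rewrite sum_fine// => i _; exact: fin_num_measure.
Qed.

Section MeasureVector.
Variables (R : realType) (G : cover_seq).

(** The step from [x] to [shift x] as seen at level [n].  The fibers of this
    map are the edge cylinders, so sums over edges are measures of its preimages
    by [fine_measure_fibers]. *)
Definition edge_at n (x : invlim G) : edge (G n) :=
  exist _ (coord x n, coord (shift x) n) (proj1 (shiftP x (shift x)) erefl n).

Lemma cyl_edgeE n (e : edge (G n)) : cyl_edge e = edge_at n @^-1` [set e].
Proof.
apply/seteqP; split=> x; last by move=> <-.
by move=> [xe sxe]; apply: val_inj; rewrite /= xe sxe -surjective_pairing.
Qed.

Lemma measurable_edge_at n (e : edge (G n)) :
  measurable (edge_at n @^-1` [set e] : set (borel G)).
Proof.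
rewrite -cyl_edgeE; apply: measurableI.
  exact: measurable_coord_preimage [set _].
rewrite -[X in measurable X]setTI; apply: measurable_shift => //.
exact: measurable_coord_preimage [set _].
Qed.

Variable mu : {finite_measure set (borel G) -> \bar R}.

Lemma measure_vecE n (e : edge (G n)) :
  measure_vec mu n e = fine (mu (edge_at n @^-1` [set e])).
Proof.
rewrite /measure_vec sum_ffunE -cyl_edgeE.
have := sum_bvec R _ [ffun e => fine (mu (cyl_edge e)) : R^o] e.
rewrite sum_ffunE ffunE => <-; apply: eq_bigr => e' _.
by rewrite !ffunE.
Qed.

Lemma measure_vec_sum n (P : pred (edge (G n))) :
  \sum_(e | P e) measure_vec mu n e = fine (mu [set x | P (edge_at n x)]).
Proof.
rewrite (fine_measure_fibers _ _ _ mu _ (edge_at n : borel G -> _)).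
  by apply: eq_bigr => e _; rewrite measure_vecE.
exact: measurable_edge_at.
Qed.

(** An edge cylinder is the disjoint union of the edge cylinders of the next
    level that lie over it. *)
Lemma pushforward_measure_vec n :
  pushforward_edges (cmap G n) (measure_vec mu n.+1) = measure_vec mu n.
Proof.
apply/ffunP => e; rewrite pushforward_edgesE measure_vec_sum measure_vecE.
congr (fine (mu _)); apply/seteqP; split=> x /=.
  move/eqP <-; apply: val_inj => /=.
  by rewrite -!coordE.
by move=> <-; apply/eqP/val_inj => /=; rewrite -!coordE.
Qed.

Lemma fine_measure_cyl_vertex n (v : G n) :
  fine (mu (cyl_vertex v)) =
    \sum_(e : edge (G n) | (val e).1 == v) measure_vec mu n e.
Proof.
rewrite measure_vec_sum; congr (fine (mu _)).
by apply/seteqP; split=> x /= /eqP.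
Qed.

End MeasureVector.

(** * Contraction by the winding matrices *)

(** On zero-sum vectors [w] and [w - eps] act alike, and the rows of the
    nonnegative matrix [w - eps] sum to [1 - #|B| * eps]. *)
Lemma stochastic_contraction (R : realType) (I J : finType) (A : {set I})
    (B : {set J}) (w : I -> J -> R) (eps : R) (x : I -> R) :
  (forall i j, i \in A -> j \in B -> eps <= w i j) ->
  (forall i, i \in A -> \sum_(j in B) w i j = 1) ->
  \sum_(i in A) x i = 0 ->
  \sum_(j in B) `|\sum_(i in A) x i * w i j| <=
    (1 - #|B|%:R * eps) * \sum_(i in A) `|x i|.
Proof.
move=> epsw w1 x0.
have le_col j : j \in B ->
    `|\sum_(i in A) x i * w i j| <= \sum_(i in A) `|x i| * (w i j - eps).
  move=> jB; rewrite (_ : \sum_(i in A) x i * w i j =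
                         \sum_(i in A) x i * (w i j - eps)).
    apply: (le_trans (ler_norm_sum _ _ _)); apply: ler_sum => i iA.
    by rewrite normrM [X in _ * X]ger0_norm// subr_ge0 epsw.
  under [RHS]eq_bigr do rewrite mulrBr.
  by rewrite sumrB -mulr_suml x0 mul0r subr0.
apply: (le_trans (ler_sum _ le_col)).
rewrite exchange_big mulr_sumr/=; apply: ler_sum => i iA.
by rewrite -mulr_sumr sumrB w1// sumr_const mulr_natl mulrC.
Qed.

Section Contraction.
Variables (R : realType) (G : cover_seq) (C : circuit_family G).
Variables (M : forall n, 'M[R]_(#|C n.+1|, #|C n|)) (eps : nat -> R).
Hypothesis hC : circuit_system C.
Hypothesis hM : has_winding_matrices M.
Hypothesis hepsM : forall n i j, eps n <= M n i j.

(** The winding matrix indexed by the circuits themselves, which makes the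
    numbering disappear.  Its rows sum to 1 because pushforward preserves the
    sum of the coordinates, and normalized circuits have sum 1. *)
Lemma winding_weights n :
  exists w : {set edge (G n.+1)} -> {set edge (G n)} -> R,
  [/\ forall c c', c \in C n.+1 -> c' \in C n -> eps n <= w c c',
      forall c, c \in C n.+1 -> \sum_(c' in C n) w c c' = 1
    & forall c, c \in C n.+1 -> pushforward_edges (cmap G n) (circ_nvec R c) =
        \sum_(c' in C n) w c c' *: circ_nvec R c'].
Proof.
have [m [num [mP numP ME]]] := hM.
pose w (c : {set edge (G n.+1)}) (c' : {set edge (G n)}) : R :=
  (Per c')%:R / (Per c)%:R * (m n c c')%:R.
have pushE c : c \in C n.+1 -> pushforward_edges (cmap G n) (circ_nvec R c) =
    \sum_(c' in C n) w c c' *: circ_nvec R c'.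
  (* a combination of one term, for the scalar [1 / Per c] *)
  move=> cC; have := pushforward_edges_comb R _ _ (cmap G n) _ [set tt]%SET
    (fun=> (Per c)%:R^-1) (fun=> circ_vec R c).
  rewrite !big_set1 => ->; rewrite mP// scaler_sumr; apply: eq_bigr => c' c'C.
  rewrite /circ_nvec !scalerA; congr (_ *: _).
  have l'0 := Per_neq0 R _ c' (fintype.subsetP (hC n) _ c'C).
  have l0 := Per_neq0 R _ c (fintype.subsetP (hC n.+1) _ cC).
  by rewrite /w; field; rewrite l0 l'0.
exists w; split=> // [c c' cC c'C|c cC].
  have [_ num1] := numP n.+1; have [_ num0] := numP n.
  move: cC c'C; rewrite -num1 -num0 => /imsetP[i _ ->] /imsetP[j _ ->].
  by rewrite /w -ME; exact: hepsM.
have c1 : \sum_e circ_nvec R c e = 1.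
  by apply: sum_circ_nvec; exact: (fintype.subsetP (hC n.+1)).
rewrite -c1 -(sum_pushforward_edges R _ _ (cmap G n)) pushE//.
under [RHS]eq_bigr do rewrite sum_ffunE.
rewrite exchange_big; apply: eq_bigr => c' c'C.
under [RHS]eq_bigr do rewrite ffunE.
have := sum_circ_nvec R _ c' (fintype.subsetP (hC n) _ c'C) => c'1.
by rewrite -scaler_sumr c'1; exact/esym/mulr1.
Qed.

(** Coefficients of an edge vector on circuits need not be unique, as circuits
    may be linearly dependent; hence the bound is on some choice of them rather
    than on a norm of coefficients. *)
Definition zero_sum_comb n (r : R) (a : {ffun edge (G n) -> R^o}) :=
  exists x : {set edge (G n)} -> R, [/\ \sum_(c in C n) x c = 0,
    \sum_(c in C n) `|x c| <= r & a = \sum_(c in C n) x c *: circ_nvec R c].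

(** Nonemptiness of [C n.+1] supplies a row of the winding matrix, which is what
    forces the contraction factor to be nonnegative. *)
Lemma zero_sum_comb_push n r a : C n.+1 != finset.set0 ->
  zero_sum_comb n.+1 r a ->
  zero_sum_comb n ((1 - #|C n|%:R * eps n) * r)
    (pushforward_edges (cmap G n) a).
Proof.
move=> /set0Pn[c0 c0C] [x [x0 xr ->]].
have [w [epsw w1 pushE]] := winding_weights n.
exists (fun c' => \sum_(c in C n.+1) x c * w c c'); split.
- rewrite exchange_big -[RHS]x0; apply: eq_bigr => c cC.
  by rewrite -mulr_sumr w1// mulr1.
- apply: (le_trans (stochastic_contraction _ _ _ _ _ _ _ _ epsw w1 x0)).
  apply: ler_wpM2l => //; rewrite subr_ge0 mulr_natl -sumr_const -(w1 c0 c0C).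
  by apply: ler_sum => c' c'C; exact: epsw.
- rewrite pushforward_edges_comb; under eq_bigr => c cC do
    rewrite pushE// scaler_sumr.
  rewrite exchange_big; apply: eq_bigr => c' _; rewrite scaler_suml.
  by apply: eq_bigr => c _; rewrite scalerA.
Qed.

(** The coefficients that witness the bound at level [n] come from those at
    level [n + k], pushed down [k] times. *)
Lemma zero_sum_comb_telescope (r : R) (a : forall n, {ffun edge (G n) -> R^o}) :
  (forall n, C n != finset.set0) ->
  (forall n, pushforward_edges (cmap G n) (a n.+1) = a n) ->
  (forall n, zero_sum_comb n r (a n)) ->
  forall k n, zero_sum_comb n
    (\prod_(n <= i < n + k) (1 - #|C i|%:R * eps i) * r) (a n).
Proof.
move=> C0 push_a ar; elim=> [|k IH] n.
  by rewrite addn0 big_geq// mul1r.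
rewrite big_ltn; last by rewrite addnS ltnS leq_addr.
by rewrite -mulrA -addSnnS -push_a; apply: zero_sum_comb_push.
Qed.

Lemma zero_sum_comb_bound n r a e : zero_sum_comb n r a -> `|a e| <= r.
Proof.
move=> [x [_ xr ->]]; apply: le_trans xr; rewrite sum_ffunE.
apply: (le_trans (ler_norm_sum _ _ _)); apply: ler_sum => c _.
rewrite ffunE normrM ler_piMr//; exact: circ_nvec_le1.
Qed.

(** Normalized circuits and the vector of a probability all have coordinate sum
    1, so the coefficients form a convex combination. *)
Lemma expresses_comb (mu : probability (borel G) R) n : expresses C mu ->
  exists s : {set edge (G n)} -> R,
  [/\ forall c, c \in C n -> 0 <= s c, \sum_(c in C n) s c = 1 &
      measure_vec mu n = \sum_(c in C n) s c *: circ_nvec R c].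
Proof.
move=> /(_ n)[s [s0 sE]]; exists s; split=> //.
have <- : \sum_e measure_vec mu n e = 1.
  rewrite measure_vec_sum (_ : mkset _ = [set: borel G]); last exact/seteqP.
  exact: (congr1 fine (probability_setT mu)).
rewrite sE; under [RHS]eq_bigr do rewrite sum_ffunE.
rewrite exchange_big; apply: eq_bigr => c cC.
under eq_bigr do rewrite ffunE.
rewrite -scaler_sumr sum_circ_nvec ?(fintype.subsetP (hC n))//.
exact/esym/mulr1.
Qed.

Lemma measure_vec_unique (mu nu : probability (borel G) R) :
  (forall n,
    (\prod_(n <= i < N) (1 - #|C i|%:R * eps i)) @[N --> \oo] --> (0 : R)) ->
  expresses C mu -> expresses C nu ->
  forall n, measure_vec mu n = measure_vec nu n.
Proof.
move=> hprod Cmu Cnu n.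
(* a probability cannot be expressed by an empty set of circuits *)
have C0 k : C k != finset.set0.
  have [s [_ s1 _]] := expresses_comb mu k Cmu.
  apply/eqP => Ck; move: s1; rewrite Ck big_set0 => /esym/eqP.
  by rewrite oner_eq0.
pose a k := measure_vec mu k - measure_vec nu k.
have aE k : a k = measure_vec mu k - measure_vec nu k by [].
have push_a k : pushforward_edges (cmap G k) (a k.+1) = a k.
  by rewrite aE pushforward_edgesB !pushforward_measure_vec.
have comb_a k : zero_sum_comb k 2 (a k).
  have [s [s0 s1 sE]] := expresses_comb mu k Cmu.
  have [t [t0 t1 tE]] := expresses_comb nu k Cnu.
  exists (fun c => s c - t c); split.
  - by rewrite sumrB s1 t1 subrr.
  - rewrite -[2]/(1 + 1) -{1}s1 -t1 -big_split/=; apply: ler_sum => c cC.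
    by rewrite (le_trans (ler_normB _ _))// !ger0_norm ?s0 ?t0.
  - by rewrite aE sE tE -sumrB; apply: eq_bigr => c _; rewrite scalerBl.
apply/eqP; rewrite -subr_eq0 -aE; apply/eqP/ffunP => e.
rewrite [RHS]ffunE; apply/eqP; rewrite -normr_le0 leNgt; apply/negP => ae0.
have : \forall N \near \oo,
    \prod_(n <= i < N) (1 - #|C i|%:R * eps i) < `|a n e| / 2.
  by apply: cvgr_lt (hprod n) _ _; rewrite divr_gt0.
move=> [N _ NP]; have := NP (n + N)%N (leq_addl _ _).
rewrite /= ltNge => /negP; apply.
rewrite ler_pdivrMr//.
have := zero_sum_comb_telescope _ _ C0 push_a comb_a N n.
exact: zero_sum_comb_bound.
Qed.

End Contraction.

Theorem theorem6p7 (R : realType) (G : cover_seq) (C : circuit_family G)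
    (M : forall n, 'M[R]_(#|C n.+1|, #|C n|)) (eps : nat -> R)
    (hC : circuit_system C)
    (hexpr : expresses_all R C)
    (hM : has_winding_matrices M)
    (heps : forall n, 0 < eps n)
    (hepsM : forall n i j, eps n <= M n i j)
    (hprod : forall n,
      (\prod_(n <= i < N) (1 - #|C i|%:R * eps i)) @[N --> \oo] --> (0 : R)) :
  uniquely_ergodic R G.
Proof.
have [mu imu] := invariant_probability_exists R G.
exists mu; split=> // nu inu; apply: eq_probability_cyl => n v.
have cyl_fin (P : probability (borel G) R) : P (cyl_vertex v) \is a fin_num.
  apply: fin_num_measure.
  exact: (measurable_coord_preimage G n [set v]).
rewrite -[LHS]fineK// -[RHS]fineK// !fine_measure_cyl_vertex; congr _%:E.
apply: eq_bigr => e _.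
by rewrite (measure_vec_unique _ _ _ _ _ hC hM hepsM mu nu hprod)//;
  exact: hexpr.
Qed.
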